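(* Let $X=Y=\mathbb{R}^{n}$ with duality product $\langle\cdot,\cdot\rangle$ the usual scalar product and $\|\cdot\|$ the Euclidean norm, and let $\lambda>0$ and $\epsilon>0$. Let $$M=\{(x,y)\in X\times Y \mid \|y-\lambda x\|\leq \epsilon\}$$ be the graph of the blurred elastic law, and define $b:X\times Y\to\mathbb{R}\cup\{+\infty\}$ by $$b(x,y)=\langle x,y\rangle+\frac{1}{2\lambda}\Big(\big(\|y-\lambda x\|-\epsilon\big)_{+}\Big)^{2},\qquad (\alpha)_{+}=\max(\alpha,0).$$ Then $b$ is a bipotential and it represents the law, i.e. $M=M(b)$. Equivalently, for $(x,y)\in X\times Y$, the relation $\|y-\lambda x\|\leq\epsilon$ can be put in the form $y\in\partial b(\cdot,y)(x)$, that is, the two relations are equivalent.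
   Context: Write $\bar{\mathbb{R}}=\mathbb{R}\cup\{+\infty\}$. The subdifferential of $\phi:X\to\bar{\mathbb{R}}$ at $x\in X$ is the (possibly empty) set $\partial\phi(x)=\{u\in Y \mid \forall z\in X,\ \langle z-x,u\rangle\leq\phi(z)-\phi(x)\}$, and similarly for functions on $Y$ (with subgradients in $X$). The notation $\partial b(\cdot,y)(x)$ means the subdifferential at $x$ of the function $z\mapsto b(z,y)$ on $X$, and $\partial b(x,\cdot)(y)$ means the subdifferential at $y$ of the function $w\mapsto b(x,w)$ on $Y$. A bipotential is a function $b:X\times Y\to\bar{\mathbb{R}}$ such that: (a) $b$ is convex and lower semicontinuous in each argument; (b) $b(x,y)\geq\langle x,y\rangle$ for all $x\in X$, $y\in Y$; (c) for all $(x,y)\in X\times Y$: $y\in\partial b(\cdot,y)(x)\iff x\in\partial b(x,\cdot)(y)\iff b(x,y)=\langle x,y\rangle$. The graph of a bipotential $b$ is $M(b)=\{(x,y)\in X\times Y\mid b(x,y)=\langle x,y\rangle\}$. A law with graph $M$ is represented by (admits) the bipotential $b$ if $M=M(b)$. *)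

(* Defs.v *)
From HB Require Import structures.
From mathcomp Require Import all_boot all_order all_algebra.
From mathcomp Require Import all_classical all_reals all_analysis.

Set Implicit Arguments.
Unset Strict Implicit.
Unset Printing Implicit Defensive.

Import Order.TTheory GRing.Theory Num.Theory.
Import numFieldNormedType.Exports.

Local Open Scope classical_set_scope.
Local Open Scope ring_scope.

(* R^n is 'rV[R]_n with its product topology, which is the Euclidean one.
   The norm `|x| on 'rV[R]_n is the sup norm, so the Euclidean norm is defined
   here from the scalar product. *)
Definition dot (R : realType) (n : nat) (x y : 'rV[R]_n) : R :=
  \sum_(i < n) x 0 i * y 0 i.

Definition enorm (R : realType) (n : nat) (x : 'rV[R]_n) : R :=
  Num.sqrt (dot x x).

(* Meant for phi with values in R U {+oo}; at t = 0 or 1 the convention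
   0 * +oo = 0 applies. *)
Definition convex_ereal (R : realType) (n : nat) (phi : 'rV[R]_n -> \bar R) :=
  forall (x y : 'rV[R]_n) (t : R), 0 <= t <= 1 ->
    (phi (t *: x + (1 - t) *: y)%R <= t%:E * phi x + (1 - t)%R%:E * phi y)%E.

(* If phi x = +oo, then phi x - phi x = -oo in \bar R and the inequality at
   z = x fails: the subdifferential is empty outside the effective domain,
   including when phi is identically +oo. X = Y = R^n and dot is symmetric, so
   one definition serves for functions on X and functions on Y. *)
Definition subdifferential (R : realType) (n : nat)
    (phi : 'rV[R]_n -> \bar R) (x : 'rV[R]_n) : set 'rV[R]_n :=
  [set u | forall z, ((dot (z - x)%R u)%:E <= phi z - phi x)%E].

Definition bipotential (R : realType) (n : nat)
    (b : 'rV[R]_n -> 'rV[R]_n -> \bar R) : Prop :=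
  [/\ forall x y, b x y != -oo%E,
      (forall y, convex_ereal (b^~ y) /\ lower_semicontinuous (b^~ y)) /\
      (forall x, convex_ereal (b x) /\ lower_semicontinuous (b x)),
      forall x y, ((dot x y)%:E <= b x y)%E &
      forall x y,
        (subdifferential (b^~ y) x y <-> subdifferential (b x) y x) /\
        (subdifferential (b x) y x <-> b x y = (dot x y)%:E)].

Definition bipotential_graph (R : realType) (n : nat)
    (b : 'rV[R]_n -> 'rV[R]_n -> \bar R) : set ('rV[R]_n * 'rV[R]_n) :=
  [set p | b p.1 p.2 = (dot p.1 p.2)%:E].

Definition represented_by (R : realType) (n : nat)
    (M : set ('rV[R]_n * 'rV[R]_n)) (b : 'rV[R]_n -> 'rV[R]_n -> \bar R) :=
  M = bipotential_graph b.

Definition blurred_elastic_law (R : realType) (n : nat) (lambda eps : R) :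
    set ('rV[R]_n * 'rV[R]_n) :=
  [set p | enorm (p.2 - lambda *: p.1) <= eps].

Definition blurred_elastic_b (R : realType) (n : nat) (lambda eps : R)
    (x y : 'rV[R]_n) : \bar R :=
  (dot x y +
   (2 * lambda)^-1 * Num.max (enorm (y - lambda *: x) - eps) 0 ^+ 2)%:E.

(* Main.v *)
Require Import Defs.
From mathcomp Require Import all_boot all_order all_algebra.
From mathcomp Require Import all_classical all_reals all_analysis.
From mathcomp Require Import ring lra.

Import Order.TTheory GRing.Theory Num.Theory.
Import numFieldNormedType.Exports.
Local Open Scope ring_scope.

Set Implicit Arguments.
Unset Strict Implicit.

(** Write g(w) = (2 lambda)^-1 ((|w| - eps)_+)^2, so that
    b(x, y) = <x, y> + g(y - lambda x).  The function g is continuous, convex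
    and nonnegative, and it vanishes exactly on the ball of radius eps.  Hence
    b(x, y) >= <x, y>, with equality exactly on the law.

    In either argument, b is a linear form plus g composed with an affine map
    z |-> w + m z with m <> 0: this gives convexity and lower semicontinuity.
    Moreover the vector defining the linear form is also the candidate
    subgradient: the pairing cancels in the subgradient inequality, and what
    remains says that the point minimizes z |-> g(w + m z)
    (subdifferential_pairingD).  Since m <> 0, the affine map reaches the
    centre of the ball, so that the minimum is 0 and minimizing means lying in
    the ball.  Both subdifferential conditions are thus equivalent to
    |y - lambda x| <= eps.  The lemma pairingD_penalty carries out this
    argument once; the theorem uses it with m = - lambda for the first
    argument of b and with m = 1 for the second.

    The analytic input is the triangle inequality for the Euclidean norm, here
    a consequence of Cauchy-Schwarz (dot_le_enorm). *)

(** * The scalar product and the Euclidean norm *)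

Lemma dotC (R : realType) (n : nat) (x y : 'rV[R]_n) : dot x y = dot y x.
Proof. by apply: eq_bigr => i _; rewrite mulrC. Qed.

Lemma dotDl (R : realType) (n : nat) (x y u : 'rV[R]_n) :
  dot (x + y) u = dot x u + dot y u.
Proof.
by rewrite /dot -big_split; apply: eq_bigr => i _; rewrite mxE mulrDl.
Qed.

Lemma dotZl (R : realType) (n : nat) (a : R) (x u : 'rV[R]_n) :
  dot (a *: x) u = a * dot x u.
Proof.
by rewrite /dot mulr_sumr; apply: eq_bigr => i _; rewrite mxE mulrA.
Qed.

Lemma dotBl (R : realType) (n : nat) (x y u : 'rV[R]_n) :
  dot (x - y) u = dot x u - dot y u.
Proof. by rewrite dotDl -scaleN1r dotZl mulN1r. Qed.

Lemma dot_lincomb (R : realType) (n : nat) (a c : R) (x y : 'rV[R]_n) :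
  dot (a *: x + c *: y) (a *: x + c *: y) =
  a ^+ 2 * dot x x + 2 * a * c * dot x y + c ^+ 2 * dot y y.
Proof.
rewrite dotDl !dotZl ![dot _ (_ + _)]dotC !dotDl !dotZl [dot y x]dotC; ring.
Qed.

Lemma dot_ge0 (R : realType) (n : nat) (x : 'rV[R]_n) : 0 <= dot x x.
Proof. by apply: sumr_ge0 => i _; rewrite -expr2 sqr_ge0. Qed.

Lemma enorm_ge0 (R : realType) (n : nat) (x : 'rV[R]_n) : 0 <= enorm x.
Proof. exact: sqrtr_ge0. Qed.

Lemma enorm_sqr (R : realType) (n : nat) (x : 'rV[R]_n) :
  enorm x ^+ 2 = dot x x.
Proof. exact/sqr_sqrtr/dot_ge0. Qed.

Lemma enorm0_eq0 (R : realType) (n : nat) (x : 'rV[R]_n) :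
  enorm x = 0 -> x = 0.
Proof.
move=> nx0; have /eqP : dot x x = 0 by rewrite -enorm_sqr nx0 expr0n.
rewrite psumr_eq0 => [/allP x0|i _]; last by rewrite -expr2 sqr_ge0.
apply/rowP => i; have := x0 i (mem_index_enum i).
by rewrite /= mulf_eq0 orbb mxE => /eqP.
Qed.

Lemma enorm0 (R : realType) (n : nat) : enorm (0 : 'rV[R]_n) = 0.
Proof.
by rewrite /enorm /dot big1 ?sqrtr0// => i _; rewrite mxE mul0r.
Qed.

(** Cauchy-Schwarz: for a = |x| and c = |y|, expanding 0 <= |c x - a y|^2 gives
    0 <= 2 a c (a c - <x, y>), and a c can be cancelled unless x or y is 0. *)
Lemma dot_le_enorm (R : realType) (n : nat) (x y : 'rV[R]_n) :
  dot x y <= enorm x * enorm y.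
Proof.
have [/enorm0_eq0 ->|nx] := eqVneq (enorm x) 0.
  by rewrite enorm0 mul0r /dot big1// => i _; rewrite mxE mul0r.
have [/enorm0_eq0 ->|ny] := eqVneq (enorm y) 0.
  by rewrite enorm0 mulr0 /dot big1// => i _; rewrite mxE mulr0.
have px : 0 < enorm x by rewrite lt_neqAle eq_sym nx enorm_ge0.
have py : 0 < enorm y by rewrite lt_neqAle eq_sym ny enorm_ge0.
have := dot_ge0 (enorm y *: x + (- enorm x) *: y).
rewrite dot_lincomb -!enorm_sqr => h.
rewrite -subr_ge0 -(pmulr_rge0 _ (mulr_gt0 px py)).
by nra.
Qed.

Lemma enormZ (R : realType) (n : nat) (a : R) (x : 'rV[R]_n) :
  0 <= a -> enorm (a *: x) = a * enorm x.
Proof.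
move=> a0; rewrite /enorm dotZl dotC dotZl mulrA -expr2.
by rewrite sqrtrM ?sqr_ge0// sqrtr_sqr ger0_norm.
Qed.

Lemma enormD (R : realType) (n : nat) (x y : 'rV[R]_n) :
  enorm (x + y) <= enorm x + enorm y.
Proof.
rewrite -(ler_pXn2r (n := 2)) ?nnegrE ?addr_ge0 ?enorm_ge0//.
rewrite enorm_sqr -[x]scale1r -[y]scale1r dot_lincomb !scale1r -!enorm_sqr.
have := dot_le_enorm x y; nra.
Qed.

(** * Continuity *)

Lemma continuous_sum_coord (R : realType) (n : nat)
    (F : 'I_n -> 'rV[R]_n -> R) :
  (forall i, continuous (F i)) -> continuous (fun z => \sum_i F i z).
Proof.
by move=> cF; apply: continuous_big => // -[a b]; exact: add_continuous.
Qed.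

Lemma continuous_dotl (R : realType) (n : nat) (u : 'rV[R]_n) :
  continuous (fun z : 'rV[R]_n => dot z u).
Proof.
apply: continuous_sum_coord => i z.
apply: (continuousM (s := fun z : 'rV[R]_n => z 0 i)).
  exact: coord_continuous.
exact: cst_continuous.
Qed.

Lemma continuous_enorm (R : realType) (n : nat) : continuous (@enorm R n).
Proof.
move=> z; apply: (@continuous_comp _ _ _ (fun z : 'rV[R]_n => dot z z)).
  apply: continuous_sum_coord => i {}z.
  apply: (continuousM (s := fun z : 'rV[R]_n => z 0 i)
    (t := fun z : 'rV[R]_n => z 0 i)); exact: coord_continuous.
exact: sqrt_continuous.
Qed.

Lemma lsc_EFin (R : realType) (n : nat) (f : 'rV[R]_n -> R) :
  continuous f -> lower_semicontinuous (fun z => (f z)%:E).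
Proof.
move=> cf x a; rewrite lte_fin => afx.
exists [set y | a < f y]%classic => [|y]; last by rewrite lte_fin.
exact: cvgr_gt (cf x) _ afx.
Qed.

(** * Convexity *)

Definition convex_real (R : realType) (n : nat) (g : 'rV[R]_n -> R) :=
  forall (x y : 'rV[R]_n) (t : R), 0 <= t <= 1 ->
    g (t *: x + (1 - t) *: y) <= t * g x + (1 - t) * g y.

Lemma convex_enorm (R : realType) (n : nat) : convex_real (@enorm R n).
Proof.
move=> x y t /andP[t0 t1]; rewrite -!enormZ ?subr_ge0//; exact: enormD.
Qed.

(** The map r |-> ((r - e)_+)^2 is nondecreasing and convex, hence preserves
    convexity by composition. *)
Lemma convex_sqr_excess (R : realType) (n : nat) (g : 'rV[R]_n -> R) (e : R) :
  convex_real g -> convex_real (fun w => Num.max (g w - e) 0 ^+ 2).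
Proof.
move=> cg x y t t01; have := cg x y t t01; move/andP: t01 => [t0 t1] gt.
set p := Num.max (g x - e) 0; set q := Num.max (g y - e) 0.
have [p0 gp] : 0 <= p /\ g x - e <= p.
  by rewrite !le_max !lexx ?orbT.
have [q0 gq] : 0 <= q /\ g y - e <= q.
  by rewrite !le_max !lexx ?orbT.
apply: (@le_trans _ _ ((t * p + (1 - t) * q) ^+ 2)).
  rewrite ler_pXn2r ?nnegrE//.
  - rewrite ge_max; apply/andP; split; nra.
  - by rewrite le_max lexx orbT.
  - nra.
(* The two sides of the convexity inequality of the square differ by
   t (1 - t) (p - q)^2. *)
have := mulr_ge0 (mulr_ge0 t0 (_ : 0 <= 1 - t)) (sqr_ge0 (p - q)).
rewrite subr_ge0 => /(_ t1); nra.
Qed.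

Lemma convex_real_affine (R : realType) (n : nat) (g : 'rV[R]_n -> R)
    (w : 'rV[R]_n) (m : R) :
  convex_real g -> convex_real (fun z => g (w + m *: z)).
Proof.
move=> cg x y t t01.
rewrite (_ : w + _ = t *: (w + m *: x) + (1 - t) *: (w + m *: y)).
  exact: cg.
by apply/rowP => i; rewrite !mxE; ring.
Qed.

Lemma convex_ereal_pairingD (R : realType) (n : nat) (g : 'rV[R]_n -> R)
    (u : 'rV[R]_n) :
  convex_real g -> convex_ereal (fun z => (dot z u + g z)%:E).
Proof.
move=> cg x y t t01; rewrite -!EFinM -EFinD lee_fin dotDl !dotZl.
have := cg x y t t01; lra.
Qed.

(** * Linear perturbations and the penalty term *)

(** Fermat's rule after translation by a linear form: subtracting <z - x, u>
    from both sides of the subgradient inequality leaves 0 <= g z - g x. *)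
Lemma subdifferential_pairingD (R : realType) (n : nat) (g : 'rV[R]_n -> R)
    (u x : 'rV[R]_n) :
  subdifferential (fun z => (dot z u + g z)%:E) x u <->
  forall z, g x <= g z.
Proof.
by split=> h z; have := h z; rewrite /= -EFinB lee_fin dotBl; lra.
Qed.

Definition penalty (R : realType) (n : nat) (lambda eps : R)
    (w : 'rV[R]_n) : R :=
  (2 * lambda)^-1 * Num.max (enorm w - eps) 0 ^+ 2.

Lemma penalty_ge0 (R : realType) (n : nat) (lambda eps : R) (w : 'rV[R]_n) :
  0 < lambda -> 0 <= penalty lambda eps w.
Proof.
by move=> l0; rewrite mulr_ge0 ?sqr_ge0// invr_ge0 mulr_ge0// ltW.
Qed.

Lemma penalty_eq0 (R : realType) (n : nat) (lambda eps : R) (w : 'rV[R]_n) :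
  0 < lambda -> penalty lambda eps w = 0 <-> enorm w <= eps.
Proof.
move=> l0; rewrite -[enorm w <= eps]subr_le0 -eq_maxr; split => [/eqP|/eqP h].
  by rewrite mulf_eq0 invr_eq0 mulf_eq0 pnatr_eq0 (gt_eqF l0) sqrf_eq0.
by rewrite /penalty h expr0n mulr0.
Qed.

Lemma convex_penalty (R : realType) (n : nat) (lambda eps : R) :
  0 < lambda -> convex_real (@penalty R n lambda eps).
Proof.
move=> l0 x y t t01; rewrite /penalty !(mulrCA _ (2 * lambda)^-1) -mulrDr.
rewrite ler_wpM2l ?invr_ge0 ?mulr_ge0 ?(ltW l0)//.
exact/convex_sqr_excess/t01/convex_enorm.
Qed.

Lemma continuous_penalty (R : realType) (n : nat) (lambda eps : R) :
  continuous (@penalty R n lambda eps).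
Proof.
move=> w; apply: (continuousM (s := fun=> (2 * lambda)^-1)
  (t := fun w => Num.max (enorm w - eps) 0 ^+ 2)); first exact: cst_continuous.
apply: (continuous_comp (f := fun w : 'rV[R]_n => Num.max (enorm w - eps) 0)
  (g := fun r : R => r ^+ 2)).
  apply: (@continuous_max _ _ (fun w : 'rV[R]_n => enorm w - eps) (fun=> 0)).
    apply: (continuousB (f := @enorm R n) (g := fun=> eps)).
      exact: continuous_enorm.
    exact: cst_continuous.
  exact: cst_continuous.
exact: exprn_continuous.
Qed.

(** Covers both partial functions of the bipotential.  The same u is the slope
    of the linear part and the candidate subgradient, since z |-> b(z, y) has
    linear part <z, y> and is tested against y, and z |-> b(x, z) has linear
    part <x, z> and is tested against x. *)
Lemma pairingD_penalty (R : realType) (n : nat) (lambda eps m : R)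
    (u w : 'rV[R]_n) (phi := fun z =>
      (dot z u + penalty lambda eps (w + m *: z))%:E) :
  0 < lambda -> 0 < eps -> m != 0 ->
  [/\ convex_ereal phi, lower_semicontinuous phi &
      forall x, subdifferential phi x u <-> enorm (w + m *: x) <= eps].
Proof.
move=> l0 e0 m0; split.
- exact/convex_ereal_pairingD/convex_real_affine/convex_penalty.
- apply: lsc_EFin => z.
  apply: (continuousD (f := fun z : 'rV[R]_n => dot z u)
    (g := fun z : 'rV[R]_n => penalty lambda eps (w + m *: z))).
    exact: continuous_dotl.
  apply: (continuous_comp (f := fun z : 'rV[R]_n => w + m *: z)
    (g := @penalty R n lambda eps)).
    apply: (continuousD (f := fun=> w) (g := fun z : 'rV[R]_n => m *: z)).
      exact: cst_continuous.
    exact: scaler_continuous.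
  exact: continuous_penalty.
- move=> x; rewrite subdifferential_pairingD -(penalty_eq0 _ _ l0).
  split=> [min|-> z]; last exact: penalty_ge0.
  apply/eqP; rewrite eq_le penalty_ge0// andbT.
  (* At z = - w / m the argument of the penalty is 0, the centre of the ball,
     which lies in the ball because eps > 0. *)
  apply: le_trans (min (- m^-1 *: w)) _.
  rewrite scalerA mulrN divff// scaleN1r subrr.
  by rewrite (penalty_eq0 _ _ l0).2// enorm0 ltW.
Qed.

(** * The blurred elastic law *)

Theorem proposition4p1 (R : realType) (n : nat) (lambda eps : R)
    (hlambda : 0 < lambda) (heps : 0 < eps) :
  let b := @blurred_elastic_b R n lambda eps in
  [/\ bipotential b,
      represented_by (@blurred_elastic_law R n lambda eps) b &
      forall x y : 'rV[R]_n,
        enorm (y - lambda *: x) <= eps <->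
        subdifferential (fun z => b z y) x y].
Proof.
move=> b.
have bE x y : b x y = (dot x y + penalty lambda eps (y - lambda *: x))%:E by [].
have nl0 : - lambda != 0 by rewrite oppr_eq0 gt_eqF.
have px (y : 'rV[R]_n) := pairingD_penalty y y hlambda heps nl0.
have py (x : 'rV[R]_n) :=
  pairingD_penalty x (- (lambda *: x)) hlambda heps (oner_neq0 R).
have bl y : b^~ y =
    fun z => (dot z y + penalty lambda eps (y + (- lambda) *: z))%:E.
  by apply/funext => z; rewrite scaleNr.
have br x : b x =
    fun z => (dot z x + penalty lambda eps (- (lambda *: x) + 1 *: z))%:E.
  by apply/funext => z; rewrite bE dotC scale1r [z - _]addrC.
have graph x y : b x y = (dot x y)%:E <-> enorm (y - lambda *: x) <= eps.
  rewrite -(penalty_eq0 _ _ hlambda) bE; split=> [[]|->]; last by rewrite addr0.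
  lra.
have subl x y : subdifferential (b^~ y) x y <-> enorm (y - lambda *: x) <= eps.
  by rewrite bl -scaleNr; have [_ _] := px y; apply.
have subr x y : subdifferential (b x) y x <-> enorm (y - lambda *: x) <= eps.
  rewrite br [y - _]addrC -[in enorm _](scale1r y).
  by have [_ _] := py x; apply.
split; last by move=> x y; rewrite subl.
- split=> //.
  + split=> [y|x]; [rewrite bl|rewrite br].
      by have [] := px y.
    by have [] := py x.
  + by move=> x y; rewrite bE lee_fin lerDl penalty_ge0.
  + by move=> x y; rewrite subl subr graph.
- by apply/seteqP; split=> -[x y] /= /graph.
Qed.
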